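(* Let $b\ge 2$ be an integer and $\beta=b-1$. Any base $b$ number (nonnegative integer) whose base $b$ expansion contains a digit equal to $\beta$ is a (possibly empty) base $b$ dismal product of base $b$ dismal primes.
   Context: Nonnegative integers are written in base $b$: $n=n_{k-1}\ldots n_0|_b$ denotes $\sum_i n_ib^i$ with digits $n_i\in\{0,\ldots,b-1\}$. The dismal product of $m=m_{k-1}\ldots m_0|_b$ and $n=n_{l-1}\ldots n_0|_b$ is the number $m\otimes_b n$ whose $i$-th base $b$ digit, $0\le i\le k+l-2$, is $\max\{\min\{m_j,n_{i-j}\}:0\le j\le k-1,\ 0\le i-j\le l-1\}$. This operation is commutative and associative with multiplicative identity $\beta=b-1$; an empty dismal product is defined to be $\beta$. A base $b$ dismal prime is a number different from $\beta$ whose only factorization (under $\otimes_b$) is $\beta$ times itself. *)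

(* Defs.v *)
From mathcomp Require Import all_boot.
Set Implicit Arguments.
Unset Strict Implicit.
Unset Printing Implicit Defensive.

Definition digit (b n i : nat) : nat := (n %/ b ^ i) %% b.

(* [trunc_log b 0 = 0], so 0 has the one-digit expansion [:: 0]. *)
Definition ndigits (b n : nat) : nat := (trunc_log b n).+1.

(* Least significant digit first, without leading zeros (except for n = 0). *)
Definition expansion (b n : nat) : seq nat := mkseq (digit b n) (ndigits b n).

Definition dismal_mul_digit (b m n i : nat) : nat :=
  \max_(j < ndigits b m | (j <= i) && (i - j < ndigits b n))
     minn (digit b m j) (digit b n (i - j)).

Definition dismal_mul (b m n : nat) : nat :=
  \sum_(i < (ndigits b m + ndigits b n).-1) dismal_mul_digit b m n i * b ^ i.

(* "Only factorization" is up to the order of the two factors. *)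
Definition dismal_prime (b p : nat) : Prop :=
  p <> b.-1 /\
  forall m n, dismal_mul b m n = p ->
    (m = b.-1 /\ n = p) \/ (m = p /\ n = b.-1).

(* The value on [::] is the identity b - 1. *)
Definition dismal_prod (b : nat) (s : seq nat) : nat :=
  \big[dismal_mul b / b.-1]_(p <- s) p.

(* Main.v *)
Require Import Defs.
From mathcomp Require Import all_boot.

(** Only factorizations into two numbers having at least two digits matter.
    A digit [b.-1] of a dismal product is a maximum of minima, so it can only
    come from a digit [b.-1] in each factor; hence the property of containing
    such a digit passes to all factors of [n].  A one-digit factor is then
    [b.-1] itself, the identity.  So if [n] is neither [b.-1] nor prime, it is
    a product of two numbers with at least two digits each
    ([dismal_prime_or_factor]).  The position of the leading digit is
    superadditive on nonzero factors ([trunc_log_dismal_mul]), so both are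
    shorter than [n], and induction on the length applies; associativity joins
    the two products of primes thus obtained.

    The algebra of the dismal product is read off its threshold sets: writing
    [S_t(n)] for the set of positions where the digit of [n] is at least [t],
    one has [S_t(m (x) n) = S_t(m) + S_t(n)] for [t > 0]
    ([leq_digit_dismal_mul]).  Since a number is determined by its threshold
    sets ([digit_threshold_inj]), associativity and the unit laws reduce to
    those of sumsets of natural numbers. *)

(** * Digits in base b *)

Section Digits.

Variables (b : nat) (hb : 1 < b).

Let b_gt0 : 0 < b. Proof. exact: ltnW. Qed.

Lemma ltn_digit n i : digit b n i < b.
Proof. exact: ltn_pmod. Qed.

Lemma digit_lt_base n i : n < b -> digit b n i = if i == 0 then n else 0.
Proof.
rewrite /digit; case: i => [|i] ltnb /=; first by rewrite divn1 modn_small.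
by rewrite divn_small ?mod0n // expnS (leq_trans ltnb) // leq_pmulr ?expn_gt0 ?b_gt0.
Qed.

Lemma digit_inj m n : digit b m =1 digit b n -> m = n.
Proof.
elim/ltn_ind: m n => m IH n eq_mn.
have eq0 : m %% b = n %% b by have := eq_mn 0; rewrite /digit expn0 !divn1.
have eqS : digit b (m %/ b) =1 digit b (n %/ b).
  by move=> i; have := eq_mn i.+1; rewrite /digit expnS !divnMA.
have [m0|m_gt0] := posnP m; last first.
  by rewrite (divn_eq m b) (divn_eq n b) eq0 (IH _ _ _ eqS) // ltn_Pdiv.
(* When m = 0 the quotient m %/ b is not smaller than m: look at the leading
   digit of n instead. *)
rewrite {}m0 in eq_mn *; have [-> //|n_gt0] := posnP n.
have /andP[lo hi] := trunc_log_bounds hb n_gt0.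
have := eq_mn (trunc_log b n).
rewrite /digit div0n mod0n modn_small; last by rewrite ltn_divLR ?expn_gt0 ?b_gt0 -?expnS.
by move/esym/eqP; rewrite -leqn0 leqNgt divn_gt0 ?expn_gt0 ?b_gt0 // lo.
Qed.

Lemma digit_threshold_inj m n :
  (forall t i, 0 < t -> t <= digit b m i <-> t <= digit b n i) -> m = n.
Proof.
move=> mn; apply: digit_inj => i; apply/eqP; rewrite eqn_leq.
have le_of_thr x y : (0 < x -> x <= y) -> x <= y by case: x => // x; exact.
by apply/andP; split; apply: le_of_thr => t_gt0; apply/(mn _ _ t_gt0).
Qed.

Lemma digit_gt0_trunc_log n i : 0 < digit b n i -> i <= trunc_log b n.
Proof.
move=> d_gt0; apply: trunc_log_max => //.
rewrite -divn_gt0 ?expn_gt0 ?b_gt0 //.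
by move: d_gt0; rewrite /digit; case: (_ %/ _) => //; rewrite mod0n.
Qed.

Lemma digit_trunc_log_gt0 n : 0 < n -> 0 < digit b n (trunc_log b n).
Proof.
move=> n_gt0; have /andP[lo hi] := trunc_log_bounds hb n_gt0.
rewrite /digit modn_small; last by rewrite ltn_divLR ?expn_gt0 ?b_gt0 -?expnS.
by rewrite divn_gt0 ?expn_gt0 ?b_gt0.
Qed.

Lemma digit_sum k (f : nat -> nat) i : (forall j, f j < b) ->
  digit b (\sum_(j < k) f j * b ^ j) i = if i < k then f i else 0.
Proof.
elim: k f i => [|k IH] f i fb; first by rewrite big_ord0 /digit div0n mod0n.
have -> : \sum_(j < k.+1) f j * b ^ j
          = (\sum_(j < k) f j.+1 * b ^ j) * b + f 0.
  rewrite big_ord_recl expn0 muln1 addnC big_distrl /=; congr (_ + _).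
  by apply: eq_bigr => j _; rewrite -mulnA -expnSr.
case: i => [|i]; first by rewrite /digit divn1 modnMDl modn_small.
rewrite ltnS -(IH (fun j => f j.+1)) // /digit expnS divnMA.
by rewrite divnMDl ?b_gt0 // [f 0 %/ b]divn_small ?addn0.
Qed.

End Digits.

(** * Algebra of the dismal product *)

Lemma leq_bigmaxP (I : finType) (P : pred I) (F : I -> nat) t : 0 < t ->
  reflect (exists2 i, P i & t <= F i) (t <= \max_(i | P i) F i).
Proof.
move=> t_gt0; apply: (iffP idP) => [|[i Pi /leq_trans]]; last first.
  by apply; apply: leq_bigmax_cond.
case: (pickP [pred i | P i && (t <= F i)]) => [i /andP[] /=|noF]; first by exists i.
rewrite leqNgt => /negP[]; rewrite -(prednK t_gt0) ltnS; apply/bigmax_leqP => i Pi.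
by have /negbT := noF i; rewrite /= Pi /= -ltnNge -{1}(prednK t_gt0) ltnS.
Qed.

Section DismalMul.

Variables (b : nat) (hb : 1 < b).

Lemma leq_digit_top n i : digit b n i <= b.-1.
Proof. by rewrite -ltnS (prednK (ltnW hb)) ltn_digit. Qed.

Lemma ltn_dismal_mul_digit m n i : dismal_mul_digit b m n i < b.
Proof.
apply: (@leq_ltn_trans b.-1); last by rewrite ltn_predL ltnW.
by apply/bigmax_leqP => j _; rewrite geq_min leq_digit_top.
Qed.

(** No carries occur, since maxima of minima of digits are digits.  The bounds
    on the positions in the definition of the product are immaterial, since the
    digits beyond the leading one are [0 < t]. *)
Lemma leq_digit_dismal_mul m n t i : 0 < t ->
  t <= digit b (dismal_mul b m n) i <->
  exists j k, [/\ j + k = i, t <= digit b m j & t <= digit b n k].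
Proof.
move=> t_gt0; rewrite /dismal_mul digit_sum //; last exact: ltn_dismal_mul_digit.
have bnd x j : t <= digit b x j -> j < ndigits b x.
  by move=> tx; rewrite ltnS digit_gt0_trunc_log // (leq_trans t_gt0).
split.
  case: ifP => _; last by rewrite leqNgt t_gt0.
  case/(leq_bigmaxP _ _ _ _ t_gt0) => j /andP[ji _]; rewrite leq_min => /andP[tm tn].
  by exists j, (i - j); rewrite subnKC.
case=> j [k [<- tm tn]]; have [jm kn] := (bnd _ _ tm, bnd _ _ tn).
have -> : j + k < (ndigits b m + ndigits b n).-1.
  by move: jm kn; rewrite /ndigits addnS addSn /= !ltnS; apply: leq_add.
apply/leq_bigmaxP => //; exists (Ordinal jm); rewrite /= addKn ?leq_addr //.
by rewrite leq_min tm.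
Qed.

Lemma dismal_mulA : associative (dismal_mul b).
Proof.
move=> x y z; apply: (digit_threshold_inj _ hb) => t i t_gt0; split.
  case/leq_digit_dismal_mul=> // j [r [<- tx /leq_digit_dismal_mul]].
  case=> // k [l [<- ty tz]]; apply/leq_digit_dismal_mul => //.
  exists (j + k), l; split; rewrite ?addnA //.
  by apply/leq_digit_dismal_mul => //; exists j, k.
case/leq_digit_dismal_mul=> // r [l [<- /leq_digit_dismal_mul + tz]].
case=> // j [k [<- tx ty]]; apply/leq_digit_dismal_mul => //.
exists j, (k + l); split; rewrite ?addnA //.
by apply/leq_digit_dismal_mul => //; exists k, l.
Qed.

Lemma digit_top i : digit b b.-1 i = if i == 0 then b.-1 else 0.
Proof. by rewrite digit_lt_base // ltn_predL ltnW. Qed.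

Lemma dismal_mul1r : left_id b.-1 (dismal_mul b).
Proof.
move=> n; apply: (digit_threshold_inj _ hb) => t i t_gt0; split.
  case/leq_digit_dismal_mul=> // j [k [<- + tn]].
  by rewrite digit_top; case: eqP => [->|_] //; rewrite leqNgt t_gt0.
move=> tn; apply/leq_digit_dismal_mul => //; exists 0, i; split=> //.
by rewrite digit_top (leq_trans tn) ?leq_digit_top.
Qed.

Lemma dismal_mulr1 : right_id b.-1 (dismal_mul b).
Proof.
move=> n; apply: (digit_threshold_inj _ hb) => t i t_gt0; split.
  case/leq_digit_dismal_mul=> // j [k [<- tn]].
  by rewrite digit_top; case: eqP => [->|_]; rewrite ?addn0 // leqNgt t_gt0.
move=> tn; apply/leq_digit_dismal_mul => //; exists i, 0; split=> //.
  exact: addn0.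
by rewrite digit_top (leq_trans tn) ?leq_digit_top.
Qed.

Lemma dismal_prod_cat s1 s2 :
  dismal_prod b (s1 ++ s2) = dismal_mul b (dismal_prod b s1) (dismal_prod b s2).
Proof.
elim: s1 => [|p s1 IH]; first by rewrite /dismal_prod big_nil dismal_mul1r.
by rewrite /dismal_prod /= !big_cons -!/(dismal_prod b _) IH dismal_mulA.
Qed.

(** * Factorization *)

(** At the sum of the two leading positions the product has a positive digit,
    being at least the minimum of the two leading digits. *)
Lemma trunc_log_dismal_mul m n : 0 < m -> 0 < n ->
  trunc_log b m + trunc_log b n <= trunc_log b (dismal_mul b m n).
Proof.
move=> m_gt0 n_gt0; apply: digit_gt0_trunc_log => //.
apply/leq_digit_dismal_mul => //.
by exists (trunc_log b m), (trunc_log b n); rewrite !digit_trunc_log_gt0.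
Qed.

Definition has_top_digit n := exists i, digit b n i = b.-1.

Lemma has_top_digit_gt0 n : has_top_digit n -> 0 < n.
Proof.
case: n => // -[i]; rewrite /digit div0n mod0n.
by case: (b) hb => [|[|c]].
Qed.

Lemma has_top_digit_mul m n :
  has_top_digit (dismal_mul b m n) -> has_top_digit m /\ has_top_digit n.
Proof.
case=> i di; have top_gt0 : 0 < b.-1 by rewrite -ltnS prednK // ltnW.
have /leq_digit_dismal_mul : b.-1 <= digit b (dismal_mul b m n) i by rewrite di.
case=> // j [k [_ tm tn]].
by split; [exists j | exists k]; apply/eqP; rewrite eqn_leq leq_digit_top.
Qed.

Lemma one_digit_top n : has_top_digit n -> trunc_log b n = 0 -> n = b.-1.
Proof.
move=> top logn; have n_ltb : n < b.
  by have := trunc_log_ltn n hb; rewrite logn expn1.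
case: top => i; rewrite digit_lt_base //; case: eqP => // _ b1.
by move: hb; rewrite -(prednK (ltnW hb)) -b1.
Qed.

Lemma dismal_prime_or_factor n : has_top_digit n -> n <> b.-1 ->
  dismal_prime b n \/
  exists m k, [/\ dismal_mul b m k = n, 0 < trunc_log b m & 0 < trunc_log b k].
Proof.
move=> top nb.
(* Factors are no longer than n, so the search for a factorization is finite
   and primality is decidable. *)
pose N := b ^ (trunc_log b n).+1.
pose splits (m k : nat) :=
  [&& dismal_mul b m k == n, 0 < trunc_log b m & 0 < trunc_log b k].
have [/existsP[m /existsP[k /and3P[/eqP mk lm lk]]]|noF] :=
  boolP [exists m : 'I_N, exists k : 'I_N, splits m k].
  by right; exists m, k.
left; split=> // m k mk; move: (top); rewrite -{1}mk => /has_top_digit_mul[topm topk].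
have := @trunc_log_dismal_mul _ _ (has_top_digit_gt0 _ topm) (has_top_digit_gt0 _ topk).
rewrite mk => len.
have [lm0|lm] := posnP (trunc_log b m).
  by left; move: mk; rewrite (one_digit_top _ topm lm0) dismal_mul1r.
have [lk0|lk] := posnP (trunc_log b k).
  by right; move: mk; rewrite (one_digit_top _ topk lk0) dismal_mulr1.
have bnd x : trunc_log b x <= trunc_log b n -> x < N.
  move=> lx; apply: leq_trans (trunc_log_ltn x hb) _.
  by rewrite leq_pexp2l // ltnW.
have mN : m < N by apply/bnd/(leq_trans _ len)/leq_addr.
have kN : k < N by apply/bnd/(leq_trans _ len)/leq_addl.
case/negP: noF; apply/existsP; exists (Ordinal mN).
by apply/existsP; exists (Ordinal kN); rewrite /splits /= mk eqxx lm.
Qed.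

Lemma dismal_factorization n : has_top_digit n ->
  exists s : seq nat,
    (forall p, p \in s -> dismal_prime b p) /\ n = dismal_prod b s.
Proof.
have [l] := ubnP (trunc_log b n); elim: l n => // l IH n ltl top.
have [->|/eqP nb] := eqVneq n b.-1.
  by exists [::]; rewrite /dismal_prod big_nil.
have [pr|[m [k [mk lm lk]]]] := dismal_prime_or_factor _ top nb.
  exists [:: n]; split=> [p|]; first by rewrite inE => /eqP->.
  by rewrite /dismal_prod big_cons big_nil dismal_mulr1.
move: (top); rewrite -{1}mk => /has_top_digit_mul[topm topk].
have := @trunc_log_dismal_mul _ _ (has_top_digit_gt0 _ topm) (has_top_digit_gt0 _ topk).
rewrite mk => len.
have ltm : trunc_log b m < l.
  by rewrite -ltnS (leq_trans _ ltl) // ltnS (leq_trans _ len) // -addn1 leq_add2l.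
have ltk : trunc_log b k < l.
  by rewrite -ltnS (leq_trans _ ltl) // ltnS (leq_trans _ len) // -add1n leq_add2r.
have [s1 [pr1 e1]] := IH _ ltm topm; have [s2 [pr2 e2]] := IH _ ltk topk.
exists (s1 ++ s2); rewrite dismal_prod_cat -e1 -e2 mk; split=> // p.
by rewrite mem_cat => /orP[/pr1|/pr2].
Qed.

End DismalMul.

Theorem theorem7 (b : nat) (hb : 2 <= b) (n : nat)
    (hn : b.-1 \in expansion b n) :
  exists s : seq nat,
    (forall p : nat, p \in s -> dismal_prime b p) /\ n = dismal_prod b s.
Proof.
by apply: dismal_factorization => //; case/mapP: hn => i _ top; exists i.
Qed.
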